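(* Let $n\ge2$ and let $\lambda_1(t),\dots,\lambda_n(t)$ satisfy $$\lambda_i'+\lambda_i^2=\frac1n\sum_{k=1}^n\lambda_k^2,\qquad i=1,\dots,n,$$ with $\sum_{i=1}^n\lambda_i(0)=0$. Put $m=[n/2]$. Then the following $[n/2]+1$ quantities are constant in time: the sum $$\sum_{i=1}^n\lambda_i(t)=0,$$ and the products $\Pi_1,\dots,\Pi_m$ defined as follows. If $n=2m$ is even, $$\Pi_1=(\lambda_1-\lambda_2)(\lambda_3-\lambda_4)\cdots(\lambda_{n-1}-\lambda_n),$$ and for $2\le k\le m$, $\Pi_k$ is obtained from $\Pi_1$ by replacing the two factors $(\lambda_{2k-3}-\lambda_{2k-2})(\lambda_{2k-1}-\lambda_{2k})$ with $(\lambda_{2k-3}-\lambda_{2k-1})(\lambda_{2k-2}-\lambda_{2k})$. If $n=2m+1$ is odd, $$\Pi_1=(\lambda_1-\lambda_2)(\lambda_2-\lambda_3)\cdots(\lambda_{n-1}-\lambda_n)(\lambda_n-\lambda_1),$$ and for $2\le k\le m$, $\Pi_k$ is obtained from $\Pi_1$ by replacing the three factors $(\lambda_{2k-3}-\lambda_{2k-2})(\lambda_{2k-2}-\lambda_{2k-1})(\lambda_{2k-1}-\lambda_{2k})$ with $(\lambda_{2k-3}-\lambda_{2k-1})(\lambda_{2k-2}-\lambda_{2k-1})(\lambda_{2k-2}-\lambda_{2k})$.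
   Context: The ODE system is the spectral form of the restricted Euler equations $\partial_tM+u\cdot\nabla M+M^2=\frac1n(\operatorname{tr}M^2)I_{n\times n}$, where $\lambda_1,\dots,\lambda_n$ are the (possibly complex) eigenvalues of $M$ and $'=\partial_t+u\cdot\nabla$ is differentiation along particle paths $\frac{dx}{dt}=u(x,t)$. The invariants hold on the interval of existence of the solution. $[\cdot]$ denotes the integer part. *)

(* Defs.v *)
From Stdlib Require Import Reals Arith.
From Coquelicot Require Import Coquelicot.

Open Scope C_scope.

Definition is_interval (J : R -> Prop) : Prop :=
  forall a b c : R, J a -> J c -> (a <= b <= c)%R -> J b.

(* As [is_derive], but for increments staying in J, so that the derivative is
   one-sided at an endpoint of J belonging to J. *)
Definition is_derive_in (J : R -> Prop) (f : R -> C) (t : R) (l : C) : Prop :=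
  filterdiff (K := R_AbsRing) (U := R_NormedModule) (V := C_R_NormedModule)
    f (within J (locally t)) (fun h : R => scal h l).

Definition Csum (a : nat -> C) (n : nat) : C :=
  sum_n_m (G := C_AbelianMonoid) a 1 n.

Definition Cprod (a : nat -> C) (n : nat) : C :=
  Iter.iter_nat Cmult 1 a 1 n.

(* The eigenvalues are lam 1, ..., lam n; other indices are irrelevant. *)
Definition spectral_restricted_Euler
    (n : nat) (J : R -> Prop) (lam : nat -> R -> C) : Prop :=
  forall (i : nat) (t : R), (1 <= i <= n)%nat -> J t ->
    exists dlam : C,
      is_derive_in J (lam i) t dlam /\
      dlam + lam i t ^ 2 = 1 / RtoC (INR n) * Csum (fun k => lam k t ^ 2) n.

Definition replace_factor (j : nat) (c : C) (a : nat -> C) : nat -> C :=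
  fun i => if Nat.eqb i j then c else a i.

(* Factors of Pi_k for even n, indexed by j = 1, ..., n/2; the j-th factor of
   Pi_1 is x_{2j-1} - x_{2j}. *)
Definition even_factors (x : nat -> C) (k : nat) : nat -> C :=
  let base := fun j => x (2 * j - 1)%nat - x (2 * j)%nat in
  if Nat.leb k 1 then base
  else replace_factor (k - 1) (x (2 * k - 3)%nat - x (2 * k - 1)%nat)
      (replace_factor k (x (2 * k - 2)%nat - x (2 * k)%nat) base).

(* Factors of Pi_k for odd n, indexed by j = 1, ..., n; the j-th factor of
   Pi_1 is x_j - x_{j+1}, cyclically. *)
Definition odd_factors (n : nat) (x : nat -> C) (k : nat) : nat -> C :=
  let base := fun j => x j - (if Nat.eqb j n then x 1%nat else x (S j)) in
  if Nat.leb k 1 then base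
  else replace_factor (2 * k - 3) (x (2 * k - 3)%nat - x (2 * k - 1)%nat)
      (replace_factor (2 * k - 2) (x (2 * k - 2)%nat - x (2 * k - 1)%nat)
      (replace_factor (2 * k - 1) (x (2 * k - 2)%nat - x (2 * k)%nat) base)).

Definition Pi_prod (n k : nat) (x : nat -> C) : C :=
  if Nat.even n then Cprod (even_factors x k) (Nat.div2 n)
  else Cprod (odd_factors n x k) n.

(* Main.v *)
Require Import Defs.
From Stdlib Require Import Reals Arith Lia Lra.
From Coquelicot Require Import Coquelicot.

Local Open Scope C_scope.

(** Subtracting two of the equations gives
    [(lam_i - lam_j)' = - (lam_i + lam_j) (lam_i - lam_j)], so a product of
    differences has logarithmic derivative minus the sum of the indices'
    eigenvalues, counted with multiplicity.  In each [Pi_k] every index occurs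
    equally often (once if [n] is even, twice if [n] is odd), so this sum is a
    multiple of [lam_1 + ... + lam_n], which is conserved and vanishes.

    Since [J] may contain its endpoints, where derivatives are one-sided, the
    eigenvalues are first extended from [[a, b]] to all of [R] by constants:
    this gives continuity everywhere and ordinary derivatives on [(a, b)],
    which is what the mean value theorem needs. *)

(** * Extension by constants from a closed interval *)

Definition clamp (a b s : R) : R := Rmax a (Rmin s b).

(** Continuity is two-sided at every real, endpoints included, to suit the mean value theorem; [df]
    is constrained only inside [(a, b)]. *)
Definition deriv_on_R (a b : R) (f df : R -> R) : Prop :=
  (forall s : R, continuity_pt f s) /\
  (forall s : R, (a < s < b)%R -> is_derive f s (df s)).

(** Taken componentwise, because the mean value theorem fails for complex-valued functions. *)
Definition deriv_on (a b : R) (f df : R -> C) : Prop :=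
  deriv_on_R a b (fun s => fst (f s)) (fun s => fst (df s)) /\
  deriv_on_R a b (fun s => snd (f s)) (fun s => snd (df s)).

Lemma clamp_between (a b s : R) : (a <= b)%R -> (a <= clamp a b s <= b)%R.
Proof.
  intros hab; unfold clamp, Rmax, Rmin; repeat destruct Rle_dec; lra.
Qed.

Lemma clamp_id (a b s : R) : (a <= s <= b)%R -> clamp a b s = s.
Proof.
  intros hs; unfold clamp, Rmax, Rmin; repeat destruct Rle_dec; lra.
Qed.

(** Makes [clamp a b] continuous, with the same radius in source and target. *)
Lemma clamp_contracting (a b s t : R) :
  (Rabs (clamp a b s - clamp a b t) <= Rabs (s - t))%R.
Proof.
  unfold clamp, Rmax, Rmin, Rabs; repeat destruct Rle_dec;
    repeat destruct Rcase_abs; lra.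
Qed.

(** Restricting to [J] only adds sets to the filter, so the limit [t] persists. *)
Lemma is_filter_lim_within (J : R -> Prop) (t : R) :
  is_filter_lim (within J (locally t)) t.
Proof.
  intros P [e He]; exists e; intros y Hy _; exact (He y Hy).
Qed.

(** Near an interior point of [J] the restriction to [J] is vacuous. *)
Lemma filterdiff_within_interior (J : R -> Prop) (f : R -> R) (t l : R) :
  locally t J ->
  filterdiff (K := R_AbsRing) (U := R_NormedModule) (V := R_NormedModule)
    f (within J (locally t)) (fun h : R => scal h l) ->
  is_derive f t l.
Proof.
  intros HJ [Hlin Hd]; split; [exact Hlin|].
  intros x Hx.
  (* [filterdiff] quantifies over all limits [x] of the filter; uniqueness of limits identifies [x]
     with [t]. *)
  rewrite <- (is_filter_lim_locally_unique (V := R_NormedModule) t x Hx).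
  intros eps.
  generalize (Hd t (is_filter_lim_within J t) eps); unfold within; intros H.
  generalize (filter_and _ _ HJ H); apply filter_imp.
  intros y [Hy1 Hy2]; exact (Hy2 Hy1).
Qed.

(** [clamp a b] takes values in [[a, b]], hence in [J], so it converges along [within J] and
    one-sided differentiability suffices for continuity. Around a point of [(a, b)] it is the
    identity, so the derivative there is the ordinary one. *)
Lemma clamp_deriv_on_R (J : R -> Prop) (a b : R) (f df : R -> R) :
  (a < b)%R ->
  (forall s : R, (a <= s <= b)%R -> J s) ->
  (forall s : R, (a <= s <= b)%R ->
    filterdiff (K := R_AbsRing) (U := R_NormedModule) (V := R_NormedModule)
      f (within J (locally s)) (fun h : R => scal h (df s))) ->
  deriv_on_R a b (fun s => f (clamp a b s)) (fun s => df (clamp a b s)).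
Proof.
  intros hab hJ hd; split.
  - intros s; apply continuity_pt_filterlim.
    apply (filterlim_comp _ _ _ (clamp a b) f _
             (within J (locally (clamp a b s)))).
    + intros P [e He]; exists e; intros y Hy.
      apply He.
      * apply Rle_lt_trans with (2 := Hy); apply clamp_contracting.
      * apply hJ, clamp_between; lra.
    + apply (filterdiff_continuous_aux (K := R_AbsRing) (U := R_NormedModule)
               (V := R_NormedModule) f).
      * eexists; apply hd, clamp_between; lra.
      * apply is_filter_lim_within.
  - intros s hs.
    assert (Hloc : locally s (fun y => (a < y < b)%R)).
    { apply (locally_interval _ s a b); simpl; try lra; auto. }
    rewrite clamp_id by lra.
    apply (is_derive_ext_loc f).
    + revert Hloc; apply filter_imp; intros y Hy; rewrite clamp_id; lra.
    + apply (filterdiff_within_interior J).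
      * revert Hloc; apply filter_imp; intros y Hy; apply hJ; lra.
      * apply hd; lra.
Qed.

(** Real and imaginary parts are continuous linear maps, so the chain rule passes the derivative to
    each component. *)
Lemma clamp_deriv_on (J : R -> Prop) (a b : R) (f df : R -> C) :
  (a < b)%R ->
  (forall s : R, (a <= s <= b)%R -> J s) ->
  (forall s : R, (a <= s <= b)%R -> is_derive_in J f s (df s)) ->
  deriv_on a b (fun s => f (clamp a b s)) (fun s => df (clamp a b s)).
Proof.
  intros hab hJ hd; split.
  - apply (clamp_deriv_on_R J a b (fun s => fst (f s)) (fun s => fst (df s)));
      [exact hab | exact hJ |].
    intros s hs.
    exact (filterdiff_comp f fst _ fst (hd s hs)
             (filterdiff_linear _ (is_linear_fst (U := R_NormedModule)
                                                 (V := R_NormedModule)))).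
  - apply (clamp_deriv_on_R J a b (fun s => snd (f s)) (fun s => snd (df s)));
      [exact hab | exact hJ |].
    intros s hs.
    exact (filterdiff_comp f snd _ snd (hd s hs)
             (filterdiff_linear _ (is_linear_snd (U := R_NormedModule)
                                                 (V := R_NormedModule)))).
Qed.

(** * Differentiation rules for real and complex functions *)

Lemma deriv_on_R_const (a b c : R) :
  deriv_on_R a b (fun _ => c) (fun _ => 0%R).
Proof.
  split; intros s.
  - now apply continuity_pt_const.
  - intros _; apply (is_derive_const c s).
Qed.

Lemma deriv_on_R_plus (a b : R) (f g df dg : R -> R) :
  deriv_on_R a b f df -> deriv_on_R a b g dg ->
  deriv_on_R a b (fun s => f s + g s)%R (fun s => df s + dg s)%R.
Proof.
  intros [cf hf] [cg hg]; split.
  - intros s; exact (continuity_pt_plus f g s (cf s) (cg s)).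
  - intros s hs; exact (is_derive_plus f g s _ _ (hf s hs) (hg s hs)).
Qed.

Lemma deriv_on_R_minus (a b : R) (f g df dg : R -> R) :
  deriv_on_R a b f df -> deriv_on_R a b g dg ->
  deriv_on_R a b (fun s => f s - g s)%R (fun s => df s - dg s)%R.
Proof.
  intros [cf hf] [cg hg]; split.
  - intros s; exact (continuity_pt_minus f g s (cf s) (cg s)).
  - intros s hs; exact (is_derive_minus f g s _ _ (hf s hs) (hg s hs)).
Qed.

Lemma deriv_on_R_mult (a b : R) (f g df dg : R -> R) :
  deriv_on_R a b f df -> deriv_on_R a b g dg ->
  deriv_on_R a b (fun s => f s * g s)%R (fun s => df s * g s + f s * dg s)%R.
Proof.
  intros [cf hf] [cg hg]; split.
  - intros s; exact (continuity_pt_mult f g s (cf s) (cg s)).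
  - intros s hs.
    exact (is_derive_mult f g s _ _ (hf s hs) (hg s hs) Rmult_comm).
Qed.

Lemma deriv_on_R_ext (a b : R) (f g df dg : R -> R) :
  (forall s : R, f s = g s) ->
  (forall s : R, (a < s < b)%R -> df s = dg s) ->
  deriv_on_R a b f df -> deriv_on_R a b g dg.
Proof.
  intros e de [cf hf]; split.
  - intros s; exact (continuity_pt_ext f g s e (cf s)).
  - intros s hs; rewrite <- (de s hs); exact (is_derive_ext f g s _ e (hf s hs)).
Qed.

(** The mean value theorem gives [f b - f a = 0 * (b - a)]. *)
Lemma deriv_on_R_zero (a b : R) (f : R -> R) :
  (a < b)%R -> deriv_on_R a b f (fun _ => 0%R) -> f a = f b.
Proof.
  intros hab [cf hf].
  destruct (MVT_gen f a b (fun _ => 0%R)) as [c [_ hc]].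
  - rewrite Rmin_left, Rmax_right by lra; exact hf.
  - intros x _; apply cf.
  - lra.
Qed.

Lemma deriv_on_ext (a b : R) (f g df dg : R -> C) :
  (forall s : R, f s = g s) ->
  (forall s : R, (a < s < b)%R -> df s = dg s) ->
  deriv_on a b f df -> deriv_on a b g dg.
Proof.
  intros e de [h1 h2]; split.
  - revert h1; apply deriv_on_R_ext; intros s; [|intros hs];
      now rewrite ?e, ?de.
  - revert h2; apply deriv_on_R_ext; intros s; [|intros hs];
      now rewrite ?e, ?de.
Qed.

Lemma deriv_on_const (a b : R) (c : C) :
  deriv_on a b (fun _ => c) (fun _ => RtoC 0).
Proof.
  split; apply deriv_on_R_const.
Qed.

Lemma deriv_on_plus (a b : R) (f g df dg : R -> C) :
  deriv_on a b f df -> deriv_on a b g dg ->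
  deriv_on a b (fun s => f s + g s) (fun s => df s + dg s).
Proof.
  intros [f1 f2] [g1 g2]; split.
  - exact (deriv_on_R_plus _ _ _ _ _ _ f1 g1).
  - exact (deriv_on_R_plus _ _ _ _ _ _ f2 g2).
Qed.

Lemma deriv_on_minus (a b : R) (f g df dg : R -> C) :
  deriv_on a b f df -> deriv_on a b g dg ->
  deriv_on a b (fun s => f s - g s) (fun s => df s - dg s).
Proof.
  intros [f1 f2] [g1 g2]; split.
  - exact (deriv_on_R_minus _ _ _ _ _ _ f1 g1).
  - exact (deriv_on_R_minus _ _ _ _ _ _ f2 g2).
Qed.

Lemma deriv_on_mult (a b : R) (f g df dg : R -> C) :
  deriv_on a b f df -> deriv_on a b g dg ->
  deriv_on a b (fun s => f s * g s) (fun s => df s * g s + f s * dg s).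
Proof.
  intros [f1 f2] [g1 g2]; split.
  - generalize (deriv_on_R_minus _ _ _ _ _ _
      (deriv_on_R_mult _ _ _ _ _ _ f1 g1) (deriv_on_R_mult _ _ _ _ _ _ f2 g2)).
    apply deriv_on_R_ext; intros s; [reflexivity | intros _; simpl; ring].
  - generalize (deriv_on_R_plus _ _ _ _ _ _
      (deriv_on_R_mult _ _ _ _ _ _ f1 g2) (deriv_on_R_mult _ _ _ _ _ _ f2 g1)).
    apply deriv_on_R_ext; intros s; [reflexivity | intros _; simpl; ring].
Qed.

Lemma deriv_on_zero (a b : R) (f : R -> C) :
  (a < b)%R -> deriv_on a b f (fun _ => RtoC 0) -> f a = f b.
Proof.
  intros hab [h1 h2].
  rewrite (surjective_pairing (f a)), (surjective_pairing (f b)).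
  f_equal.
  - exact (deriv_on_R_zero a b (fun s => fst (f s)) hab h1).
  - exact (deriv_on_R_zero a b (fun s => snd (f s)) hab h2).
Qed.

(** * Finite sums and products and their derivatives *)

Lemma Csum_0 (x : nat -> C) : Csum x 0 = RtoC 0.
Proof. reflexivity. Qed.

Lemma Csum_S (x : nat -> C) (n : nat) : Csum x (S n) = Csum x n + x (S n).
Proof.
  unfold Csum; rewrite sum_n_Sm by lia; reflexivity.
Qed.

Lemma Cprod_S (x : nat -> C) (n : nat) : Cprod x (S n) = Cprod x n * x (S n).
Proof.
  unfold Cprod.
  rewrite (Iter.iter_nat_Chasles Cmult 1 Cmult_1_l Cmult_assoc x 1 n (S n))
    by lia.
  f_equal; apply Iter.iter_nat_point, Cmult_1_r.
Qed.

Lemma deriv_on_Csum (a b : R) (n : nat) (f df : nat -> R -> C) :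
  (forall i, (1 <= i <= n)%nat -> deriv_on a b (f i) (df i)) ->
  deriv_on a b (fun s => Csum (fun i => f i s) n)
    (fun s => Csum (fun i => df i s) n).
Proof.
  induction n as [|n IH]; intros h.
  - exact (deriv_on_const a b 0).
  - apply (deriv_on_ext a b (fun s => Csum (fun i => f i s) n + f (S n) s) _
                  (fun s => Csum (fun i => df i s) n + df (S n) s)).
    + intros s; now rewrite Csum_S.
    + intros s _; now rewrite Csum_S.
    + apply deriv_on_plus; [apply IH; intros; apply h; lia | apply h; lia].
Qed.

(** Logarithmic derivatives add up. The rates [r j] enter multiplicatively, without division, so
    factors may vanish. *)
Lemma deriv_on_Cprod (a b : R) (n : nat) (f r : nat -> R -> C) :
  (forall j, (1 <= j <= n)%nat -> deriv_on a b (f j) (fun s => r j s * f j s)) ->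
  deriv_on a b (fun s => Cprod (fun j => f j s) n)
    (fun s => Csum (fun j => r j s) n * Cprod (fun j => f j s) n).
Proof.
  induction n as [|n IH]; intros h.
  - apply (deriv_on_ext a b (fun _ => RtoC 1) _ (fun _ => RtoC 0)).
    + reflexivity.
    + intros s _; rewrite Csum_0; ring.
    + apply deriv_on_const.
  - apply (deriv_on_ext a b (fun s => Cprod (fun j => f j s) n * f (S n) s) _
      (fun s => Csum (fun j => r j s) n * Cprod (fun j => f j s) n * f (S n) s
                + Cprod (fun j => f j s) n * (r (S n) s * f (S n) s))).
    + intros s; now rewrite Cprod_S.
    + intros s _; rewrite Csum_S, Cprod_S; ring.
    + apply (deriv_on_mult a b (fun s => Cprod (fun j => f j s) n) (f (S n))
              _ (fun s => r (S n) s * f (S n) s));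
        [apply IH; intros; apply h; lia | apply h; lia].
Qed.

(** * Counting indices over the factors *)

Lemma Csum_replace_factor (x : nat -> C) (c : C) (j n : nat) :
  (1 <= j)%nat ->
  Csum (replace_factor j c x) n =
  Csum x n + (if Nat.leb j n then c - x j else 0).
Proof.
  intros hj; induction n as [|n IH].
  - rewrite !Csum_0; destruct (Nat.leb_spec j 0); [lia | ring].
  - rewrite !Csum_S, IH; unfold replace_factor.
    destruct (Nat.eqb_spec (S n) j), (Nat.leb_spec j n), (Nat.leb_spec j (S n));
      try lia; try ring.
    subst j; ring.
Qed.

(** The pairs [2j - 1, 2j] partition [1, ..., 2m]. *)
Lemma Csum_pairs (x : nat -> C) (m : nat) :
  Csum (fun j => x (2 * j - 1)%nat + x (2 * j)%nat) m = Csum x (2 * m).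
Proof.
  induction m as [|m IH]; [reflexivity|].
  replace (2 * S m)%nat with (S (S (2 * m))) by lia.
  rewrite !Csum_S, IH.
  replace (2 * S m - 1)%nat with (S (2 * m)) by lia.
  replace (2 * S m)%nat with (S (S (2 * m))) by lia.
  ring.
Qed.

Lemma Csum_shift (x : nat -> C) (n : nat) :
  Csum (fun j => x (S j)) n = Csum x (S n) - x 1%nat.
Proof.
  induction n as [|n IH].
  - rewrite !Csum_S, !Csum_0; ring.
  - rewrite Csum_S, IH, (Csum_S x (S n)); ring.
Qed.

Lemma Csum_ext (x y : nat -> C) (n : nat) :
  (forall j, (1 <= j <= n)%nat -> x j = y j) -> Csum x n = Csum y n.
Proof.
  apply sum_n_m_ext_loc.
Qed.

Lemma Csum_plus (x y : nat -> C) (n : nat) :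
  Csum (fun j => x j + y j) n = Csum x n + Csum y n.
Proof.
  induction n as [|n IH]; rewrite ?Csum_0, ?Csum_S, ?IH; ring.
Qed.

Lemma Csum_scal (c : C) (x : nat -> C) (n : nat) :
  Csum (fun j => c * x j) n = c * Csum x n.
Proof.
  induction n as [|n IH]; rewrite ?Csum_0, ?Csum_S, ?IH; ring.
Qed.

Lemma Csum_const (c : C) (n : nat) : Csum (fun _ => c) n = RtoC (INR n) * c.
Proof.
  induction n as [|n IH].
  - rewrite Csum_0; simpl; ring.
  - rewrite Csum_S, IH, S_INR, RtoC_plus; ring.
Qed.

(** On the cycle each index is once the first and once the second member of a pair. *)
Lemma Csum_cyclic (x : nat -> C) (n : nat) :
  (1 <= n)%nat ->
  Csum (fun j => x j + (if Nat.eqb j n then x 1%nat else x (S j))) n =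
  2 * Csum x n.
Proof.
  intros hn; rewrite Csum_plus.
  destruct n as [|n]; [lia|].
  rewrite (Csum_S (fun j => if Nat.eqb j (S n) then x 1%nat else x (S j))).
  rewrite Nat.eqb_refl.
  rewrite (Csum_ext _ (fun j => x (S j)) n).
  - rewrite Csum_shift; ring.
  - intros j hj; destruct (Nat.eqb_spec j (S n)); [lia | reflexivity].
Qed.

(* Each difference [x_p - x_q] of [even_factors] and [odd_factors] becomes
   [x_p + x_q], which is minus its logarithmic derivative. *)
Definition even_pair_sums (x : nat -> C) (k : nat) : nat -> C :=
  let base := fun j => x (2 * j - 1)%nat + x (2 * j)%nat in
  if Nat.leb k 1 then base
  else replace_factor (k - 1) (x (2 * k - 3)%nat + x (2 * k - 1)%nat)
      (replace_factor k (x (2 * k - 2)%nat + x (2 * k)%nat) base).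

Definition odd_pair_sums (n : nat) (x : nat -> C) (k : nat) : nat -> C :=
  let base := fun j => x j + (if Nat.eqb j n then x 1%nat else x (S j)) in
  if Nat.leb k 1 then base
  else replace_factor (2 * k - 3) (x (2 * k - 3)%nat + x (2 * k - 1)%nat)
      (replace_factor (2 * k - 2) (x (2 * k - 2)%nat + x (2 * k - 1)%nat)
      (replace_factor (2 * k - 1) (x (2 * k - 2)%nat + x (2 * k)%nat) base)).

(** The two new pairs cover the same four indices [2k - 3, ..., 2k], once each, as the two they
    replace. *)
Lemma Csum_even_pair_sums (x : nat -> C) (k m : nat) :
  (1 <= k <= m)%nat -> Csum (even_pair_sums x k) m = Csum x (2 * m).
Proof.
  intros hk; unfold even_pair_sums; cbv zeta.
  destruct (Nat.leb_spec k 1); [apply Csum_pairs|].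
  rewrite !Csum_replace_factor, Csum_pairs by lia.
  unfold replace_factor.
  destruct (Nat.leb_spec (k - 1) m), (Nat.leb_spec k m),
    (Nat.eqb_spec (k - 1) k); try lia.
  replace (2 * (k - 1) - 1)%nat with (2 * k - 3)%nat by lia.
  replace (2 * (k - 1))%nat with (2 * k - 2)%nat by lia.
  ring.
Qed.

(** Old and new triples of pairs both contain [2k - 3] and [2k] once and [2k - 2] and [2k - 1]
    twice. *)
Lemma Csum_odd_pair_sums (x : nat -> C) (n k : nat) :
  (1 <= k)%nat -> (2 * k < n)%nat ->
  Csum (odd_pair_sums n x k) n = 2 * Csum x n.
Proof.
  intros hk hkn; unfold odd_pair_sums; cbv zeta.
  destruct (Nat.leb_spec k 1); [apply Csum_cyclic; lia|].
  rewrite !Csum_replace_factor, Csum_cyclic by lia.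
  unfold replace_factor.
  (* The three replaced positions are at most [n], pairwise distinct, and differ from the
     wrap-around position [n] because [2 * k < n]. *)
  repeat match goal with
  | |- context [Nat.leb ?p ?q] => destruct (Nat.leb_spec p q); [|lia]
  | |- context [Nat.eqb ?p ?q] => destruct (Nat.eqb_spec p q); [lia|]
  end.
  replace (S (2 * k - 3)) with (2 * k - 2)%nat by lia.
  replace (S (2 * k - 2)) with (2 * k - 1)%nat by lia.
  replace (S (2 * k - 1)) with (2 * k)%nat by lia.
  ring.
Qed.

(** * Conservation laws on [[a, b]], with [q] the common right-hand side *)

Section Euler.

Context (n : nat) (a b : R) (x : nat -> R -> C) (q : R -> C).
Hypothesis hx : forall i, (1 <= i <= n)%nat ->
  deriv_on a b (x i) (fun s => q s - x i s ^ 2).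

(** The common term [q] cancels and the difference of squares factors. *)
Lemma deriv_on_difference (i j : nat) :
  (1 <= i <= n)%nat -> (1 <= j <= n)%nat ->
  deriv_on a b (fun s => x i s - x j s)
    (fun s => - (x i s + x j s) * (x i s - x j s)).
Proof.
  intros hi hj.
  generalize (deriv_on_minus _ _ _ _ _ _ (hx i hi) (hx j hj)).
  apply deriv_on_ext; intros s; [reflexivity | intros _; ring].
Qed.

Lemma deriv_on_even_factors (m k j : nat) :
  n = (2 * m)%nat -> (1 <= k <= m)%nat -> (1 <= j <= m)%nat ->
  deriv_on a b (fun s => even_factors (fun i => x i s) k j)
    (fun s => - even_pair_sums (fun i => x i s) k j
              * even_factors (fun i => x i s) k j).
Proof.
  intros hn hk hj; unfold even_factors, even_pair_sums, replace_factor; cbv zeta.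
  destruct (Nat.leb_spec k 1); [apply deriv_on_difference; lia|].
  destruct (Nat.eqb_spec j (k - 1)); [apply deriv_on_difference; lia|].
  destruct (Nat.eqb_spec j k); apply deriv_on_difference; lia.
Qed.

Lemma deriv_on_odd_factors (k j : nat) :
  (1 <= k)%nat -> (2 * k < n)%nat -> (1 <= j <= n)%nat ->
  deriv_on a b (fun s => odd_factors n (fun i => x i s) k j)
    (fun s => - odd_pair_sums n (fun i => x i s) k j
              * odd_factors n (fun i => x i s) k j).
Proof.
  intros hk hkn hj; unfold odd_factors, odd_pair_sums, replace_factor; cbv zeta.
  destruct (Nat.leb_spec k 1);
    [|destruct (Nat.eqb_spec j (2 * k - 3));
      [apply deriv_on_difference; lia|];
      destruct (Nat.eqb_spec j (2 * k - 2));
      [apply deriv_on_difference; lia|];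
      destruct (Nat.eqb_spec j (2 * k - 1));
      [apply deriv_on_difference; lia|]];
    (* Unreplaced factors remain: the wrap-around pair [n, 1] when [j = n], a consecutive pair
       otherwise. *)
    destruct (Nat.eqb_spec j n); apply deriv_on_difference; lia.
Qed.

(** Summing the equations gives the derivative [n q] minus the sum of squares, which is zero for
    this [q]. *)
Lemma Csum_conserved :
  (a < b)%R -> (1 <= n)%nat ->
  (forall s : R, q s = 1 / RtoC (INR n) * Csum (fun i => x i s ^ 2) n) ->
  Csum (fun i => x i a) n = Csum (fun i => x i b) n.
Proof.
  intros hab hn hq.
  apply (deriv_on_zero a b (fun s => Csum (fun i => x i s) n) hab).
  generalize (deriv_on_Csum a b n x _ hx).
  apply deriv_on_ext; [reflexivity|].
  intros s _.
  rewrite (Csum_ext _ (fun i => q s + (-1) * x i s ^ 2)) by (intros; ring).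
  rewrite Csum_plus, Csum_scal, Csum_const, hq.
  field.
  intros e; apply RtoC_inj in e; revert e; apply not_0_INR; lia.
Qed.

(** With [S] the sum of the [x i], the logarithmic derivative is [- S] for even [n] and [- 2 S] for
    odd [n], and [S] vanishes. *)
Lemma Pi_prod_conserved (k : nat) :
  (a < b)%R -> (1 <= k <= Nat.div2 n)%nat ->
  (forall s : R, Csum (fun i => x i s) n = RtoC 0) ->
  Pi_prod n k (fun i => x i a) = Pi_prod n k (fun i => x i b).
Proof.
  intros hab hk hS; unfold Pi_prod.
  destruct (Nat.even n) eqn:he.
  - apply Nat.even_spec in he; destruct he as [m hm].
    rewrite hm, Nat.div2_double in *; rewrite <- hm in *.
    apply (deriv_on_zero a b
      (fun s => Cprod (even_factors (fun i => x i s) k) m) hab).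
    generalize (deriv_on_Cprod a b m
      (fun j s => even_factors (fun i => x i s) k j)
      (fun j s => - even_pair_sums (fun i => x i s) k j)
      (fun j hj => deriv_on_even_factors m k j hm hk hj)).
    apply deriv_on_ext; [reflexivity|].
    intros s _.
    rewrite (Csum_ext _ (fun j => (-1) * even_pair_sums (fun i => x i s) k j))
      by (intros; ring).
    rewrite Csum_scal, Csum_even_pair_sums, <- hm, hS by assumption; ring.
  (* For [n = 2m + 1] the bound [k <= m] keeps [2k] below [n]. *)
  - assert (hkn : (2 * k < n)%nat).
    { assert (ho : Nat.odd n = true) by (unfold Nat.odd; now rewrite he).
      apply Nat.odd_spec in ho; destruct ho as [m hm].
      rewrite hm, Nat.add_1_r, Nat.div2_succ_double in hk; lia. }
    apply (deriv_on_zero a b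
      (fun s => Cprod (odd_factors n (fun i => x i s) k) n) hab).
    generalize (deriv_on_Cprod a b n
      (fun j s => odd_factors n (fun i => x i s) k j)
      (fun j s => - odd_pair_sums n (fun i => x i s) k j)
      (fun j hj => deriv_on_odd_factors k j (proj1 hk) hkn hj)).
    apply deriv_on_ext; [reflexivity|].
    intros s _.
    rewrite (Csum_ext _ (fun j => (-1) * odd_pair_sums n (fun i => x i s) k j))
      by (intros; ring).
    rewrite Csum_scal, Csum_odd_pair_sums, hS by lia; ring.
Qed.

End Euler.

(** * From the system on [J] to the invariants *)

Lemma clamp_spectral_restricted_Euler (n : nat) (J : R -> Prop)
    (lam : nat -> R -> C) (a b : R) :
  spectral_restricted_Euler n J lam ->
  (a < b)%R -> (forall s : R, (a <= s <= b)%R -> J s) ->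
  forall i, (1 <= i <= n)%nat ->
    deriv_on a b (fun s => lam i (clamp a b s))
      (fun s => 1 / RtoC (INR n) * Csum (fun k => lam k (clamp a b s) ^ 2) n
                - lam i (clamp a b s) ^ 2).
Proof.
  intros hlam hab hJ i hi.
  apply (clamp_deriv_on J a b (lam i)
    (fun s => 1 / RtoC (INR n) * Csum (fun k => lam k s ^ 2) n - lam i s ^ 2));
    [exact hab | exact hJ |].
  intros s hs.
  destruct (hlam i s hi (hJ s hs)) as [d [hd e]].
  rewrite <- e.
  (* The equation determines the existential derivative [d], which yields the explicit form required
     by [hx]. *)
  replace (d + lam i s ^ 2 - lam i s ^ 2) with d by ring.
  exact hd.
Qed.

Theorem lemma6p3 (n : nat) (J : R -> Prop) (lam : nat -> R -> C)
    (hn : (2 <= n)%nat)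
    (hJ : is_interval J)
    (hJ0 : J 0%R)
    (hlam : spectral_restricted_Euler n J lam)
    (hsum0 : Csum (fun i => lam i 0%R) n = RtoC 0) :
  (forall t : R, J t -> Csum (fun i => lam i t) n = RtoC 0) /\
  (forall k : nat, (1 <= k <= Nat.div2 n)%nat ->
    forall t : R, J t ->
      Pi_prod n k (fun i => lam i t) = Pi_prod n k (fun i => lam i 0%R)).
Proof.
  assert (hsub : forall a b, J a -> J b -> forall s, (a <= s <= b)%R -> J s)
    by (intros a b ha hb s hs; exact (hJ a s b ha hb hs)).
  assert (hS2 : forall a b, J a -> J b -> (a < b)%R ->
    Csum (fun i => lam i a) n = Csum (fun i => lam i b) n).
  { intros a b ha hb hab.
    generalize (Csum_conserved n a b _ _
      (clamp_spectral_restricted_Euler n J lam a b hlam hab (hsub a b ha hb))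
      (* [q] has been inferred as the clamped right-hand side, so its defining equation holds by
         reflexivity. *)
      hab ltac:(lia) (fun s => eq_refl)).
    now rewrite !clamp_id by lra. }
  assert (hS : forall t, J t -> Csum (fun i => lam i t) n = RtoC 0).
  { intros t ht; rewrite <- hsum0.
    (* Time [0] may lie on either side of [t], while [hS2] compares an earlier with a later time. *)
    destruct (Rtotal_order t 0) as [h | [-> | h]]; [|reflexivity|].
    - now apply hS2.
    - symmetry; now apply hS2. }
  split; [exact hS|]; intros k hk.
  assert (hP : forall a b, J a -> J b -> (a < b)%R ->
    Pi_prod n k (fun i => lam i a) = Pi_prod n k (fun i => lam i b)).
  { intros a b ha hb hab.
    generalize (Pi_prod_conserved n a b _ _
      (clamp_spectral_restricted_Euler n J lam a b hlam hab (hsub a b ha hb))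
      k hab hk
      (* Clamped times lie in [[a, b]], hence in [J], so the sum vanishes at every real [s]. *)
      (fun s => hS _ (hsub a b ha hb _ (clamp_between a b s (Rlt_le _ _ hab))))).
    now rewrite !clamp_id by lra. }
  intros t ht.
  destruct (Rtotal_order t 0) as [h | [-> | h]]; [|reflexivity|].
  - now apply hP.
  - symmetry; now apply hP.
Qed.
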